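(* Let $(X,\mathcal{A},p)$ be a standard Borel probability space. The assignments $e\mapsto\mathcal{I}_e$ and $\mathcal{B}\mapsto e_\mathcal{B}$ are mutually inverse order-preserving bijections between the partially ordered set of ($p$-a.s. classes of) measure-preserving $p$-a.s. idempotent Markov kernels on $(X,\mathcal{A},p)$ and the set of $p$-complete sub-$\sigma$-algebras of $\mathcal{A}$ ordered by inclusion.
   Context: Kernels are identified up to $p$-a.s. equality, with composition $(\ell\circ k)(C\mid x)=\int\ell(C\mid y)k(dy\mid x)$; $e$ is $p$-a.s. idempotent if $e\circ e=e$ a.s.; idempotents are ordered by $e_1\le e_2$ iff $e_1\circ e_2=e_2\circ e_1=e_1$ a.s. $\mathcal{I}_e=\{B\in\mathcal{A}: e(B\mid x)=1_B(x)$ for $p$-a.a. $x\}$. $e_\mathcal{B}(A\mid x)=\mathbb{P}[A\mid\mathcal{B}](x)$ (regular conditional probability). A sub-$\sigma$-algebra $\mathcal{B}\subseteq\mathcal{A}$ is $p$-complete if it contains every $A\in\mathcal{A}$ with $p(A)=0$. *)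

(* Defs.v *)
From HB Require Import structures.
From mathcomp Require Import all_boot all_order all_algebra.
From mathcomp Require Import all_classical all_reals all_analysis measurable_realfun.
Set Implicit Arguments. Unset Strict Implicit. Unset Printing Implicit Defensive.
Import Order.TTheory GRing.Theory Num.Theory.
Local Open Scope classical_set_scope.
Local Open Scope ring_scope.
Local Open Scope ereal_scope.

Section Defs.
Context {d : measure_display} {X : measurableType d} {R : realType}.

(* (X, A) is standard Borel: Borel-isomorphic to a Borel subset of R
   (Kuratowski: equivalent to being Borel-isomorphic to a Polish space). *)
Definition standard_borel : Prop :=
  exists f : X -> R,
    [/\ injective f, measurable_fun setT f, measurable (range f)
      & forall A : set X, measurable A -> measurable (f @` A)].

Definition kcomp_ (l k : R.-pker X ~> X) : X -> set X -> \bar R :=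
  fun x C => \int[k x]_y l y C.

Definition kae (p : probability X R) (k l : X -> set X -> \bar R) : Prop :=
  {ae p, forall x, forall C, measurable C -> k x C = l x C}.

Definition kmeas_pres (p : probability X R) (k : R.-pker X ~> X) : Prop :=
  forall C, measurable C -> \int[p]_x k x C = p C.

Definition kidem (p : probability X R) (e : R.-pker X ~> X) : Prop :=
  kae p (kcomp_ e e) (fun x C => e x C).

Definition mp_idem (p : probability X R) (e : R.-pker X ~> X) : Prop :=
  kmeas_pres p e /\ kidem p e.

Definition kle (p : probability X R) (e1 e2 : R.-pker X ~> X) : Prop :=
  kae p (kcomp_ e1 e2) (fun x C => e1 x C) /\
  kae p (kcomp_ e2 e1) (fun x C => e1 x C).

Definition inv_sets (p : probability X R) (e : R.-pker X ~> X) : set (set X) :=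
  [set B | measurable B /\
           {ae p, forall x, e x B = (\1_B x)%:E}].

Definition p_complete_subsigma (p : probability X R) (G : set (set X)) : Prop :=
  [/\ sigma_algebra setT G, G `<=` measurable
    & forall A, measurable A -> p A = 0 -> G A].

Definition is_rcp (p : probability X R) (G : set (set X)) (e : R.-pker X ~> X) : Prop :=
  forall A : set X, measurable A ->
    (forall Y : set (\bar R), measurable Y -> G ((fun x => e x A) @^-1` Y)) /\
    (forall B, G B -> \int[p]_(x in B) e x A = p (A `&` B)).

End Defs.

(* Main.v *)
(** A measure-preserving kernel [e] acts on functions by [E phi x = \int[e x] phi]
and preserves [p]-integrals. If [E g = g] a.s., then [E (max g q) >= max g q]
a.s. with equal integrals, hence equality holds a.s., which makes the sublevel
sets of [g] invariant. Applied to [g = e(A | .)], fixed by idempotence, this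
says that [e] is a regular conditional probability given its invariant sets.
Conversely, a function measurable for the invariant sets is [e x]-a.s. constant
equal to its value at [x], for a.a. [x]; hence conditional probabilities given
[G] are idempotent, and inclusion of invariant sets amounts to the order.
Equalities that hold a.s. for each event hold a.s. for all events at once because
the sigma-algebra is generated by countably many rays.

Regular conditional probabilities exist by a quantile construction: embed [X] in
the extended reals by [F], let [H q] be the Radon-Nikodym version of
[P(F < q | G)] for rational [q], and take the law of
[Q(x, u) = inf {q | u <= H q x}] for uniform [u]. This is a probability kernel
for every choice of versions, so that no null set has to be removed. *)

Require Import Defs.
From HB Require Import structures.
From mathcomp Require Import all_boot all_order all_algebra.
From mathcomp Require Import all_classical all_reals all_analysis measurable_realfun.
Set Implicit Arguments. Unset Strict Implicit. Unset Printing Implicit Defensive.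
Import Order.TTheory GRing.Theory Num.Theory.
Local Open Scope classical_set_scope.
Local Open Scope ring_scope.
Local Open Scope ereal_scope.

(** * Almost-everywhere comparison and measures of mass one *)

(** On each measurable [E] inside [D] the integral of [f] is at most that of [g]. Cancelling the
    finite integral of [f] over the rest of [D] gives the reverse inequality, and equal integrals
    over all such [E] force a.e. equality. *)
Lemma ae_eq_of_le_integral (d : measure_display) (T : measurableType d)
    (R : realType) (mu : {measure set T -> \bar R}) (D : set T)
    (f g : T -> \bar R) :
  measurable D -> measurable_fun D f -> measurable_fun D g ->
  (forall x, D x -> 0 <= f x) -> (forall x, D x -> 0 <= g x) ->
  {ae mu, forall x, D x -> f x <= g x} ->
  \int[mu]_(x in D) f x < +oo ->
  \int[mu]_(x in D) g x <= \int[mu]_(x in D) f x -> ae_eq mu D f g.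
Proof.
move=> mD mf mg f0 g0 fg foo gf; apply: integral_ae_eq => //.
  apply/integrableP; split => //.
  by rewrite (eq_integral f)// => x; rewrite inE => Dx; rewrite gee0_abs ?f0.
move=> E ED mE.
have le_on A : measurable A -> A `<=` D ->
    \int[mu]_(x in A) f x <= \int[mu]_(x in A) g x.
  move=> mA AD; apply: ae_ge0_le_integral => //.
  - by move=> x /AD; exact: f0.
  - exact: measurable_funS mf.
  - by move=> x /AD; exact: g0.
  - exact: measurable_funS mg.
  - by apply: filterS fg => x fgx /AD.
have mDE : measurable (D `\` E) by exact: measurableD.
have DE : D = E `|` (D `\` E) by rewrite setDUK.
have split_on h : measurable_fun D h -> (forall x, D x -> 0 <= h x) ->
    \int[mu]_(x in D) h x =
    \int[mu]_(x in E) h x + \int[mu]_(x in D `\` E) h x.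
  move=> mh h0; rewrite {1}DE ge0_integral_setU//; rewrite -?DE//.
  exact/disj_set2P/setDIK.
have fE_fin A : measurable A -> A `<=` D -> \int[mu]_(x in A) f x \is a fin_num.
  move=> mA AD; rewrite ge0_fin_numE; last first.
    by apply: integral_ge0 => x /AD; exact: f0.
  by apply: le_lt_trans foo; exact: ge0_subset_integral.
apply/eqP; rewrite eq_le le_on//=.
have := gf; rewrite (split_on f)// (split_on g)// => gf'.
have DED : D `\` E `<=` D by exact: subDsetl.
rewrite -(leeD2rE _ _ (fE_fin _ mDE DED)).
by apply: le_trans gf'; rewrite leeD2l// le_on.
Qed.

Lemma ae_forall_countable (d : measure_display) (T : measurableType d)
    (R : realType) (mu : {measure set T -> \bar R}) (I : countType)
    (P : I -> T -> Prop) :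
  (forall i, {ae mu, forall x, P i x}) -> {ae mu, forall x, forall i, P i x}.
Proof.
move=> aeP; pose Q n x := if unpickle n is Some i then P i x else True.
have aeQ n : {ae mu, forall x, Q n x}.
  by rewrite /Q; case: unpickle => [i|]; [exact: aeP|exact: aeW].
apply: filterS (ae_foralln aeQ) => x Qx i.
by have := Qx (pickle i); rewrite /Q pickleK.
Qed.

Lemma mass1_setC (d : measure_display) (T : measurableType d)
    (R : realType) (mu : {measure set T -> \bar R}) (B : set T) :
  measurable B -> mu setT = 1 -> mu (~` B) = 1 - mu B.
Proof.
move=> mB muT; rewrite -setTD measureD//= ?setTI; last by rewrite [ltLHS]muT ltry.
by rewrite [X in X - _]muT.
Qed.

Lemma mass1_ae (d : measure_display) (T : measurableType d)
    (R : realType) (mu : {measure set T -> \bar R}) (B : set T) :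
  measurable B -> mu setT = 1 -> mu B = 1 -> {ae mu, forall x, B x}.
Proof.
move=> mB muT muB; exists (~` B); split; first exact: measurableC.
  by rewrite mass1_setC// muB subee.
by move=> x.
Qed.

(** * Measure-preserving kernels and their invariant sets *)

Section measure_preserving_kernels.
Context (d : measure_display) (X : measurableType d) (R : realType).
Variable p : probability X R.
Implicit Types (e k l : R.-pker X ~> X) (phi g : X -> \bar R).

(** The composite [kcomp_ l k x] bundled as a measure, so that one can integrate against it. The
    library composition lets the second kernel depend on the starting point as well; [kernel_snd]
    ignores that argument. *)
Definition mkcomp_ l k x : {measure set X -> \bar R} :=
  mkcomp k (kernel.kernel_snd l) x.

Lemma integral_mkcomp_ l k x phi : (forall y, 0 <= phi y) ->
  measurable_fun setT phi ->
  \int[mkcomp_ l k x]_z phi z = \int[k x]_y \int[l y]_z phi z.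
Proof. by move=> phi0 mphi; rewrite /mkcomp_ integral_kcomp. Qed.

Lemma pker_le1 e x B : measurable B -> e x B <= 1.
Proof.
move=> mB; rewrite -(@prob_kernel _ _ _ _ _ e x).
by apply: le_measure; rewrite ?inE.
Qed.

Lemma pker_setC e x B : measurable B -> e x (~` B) = 1 - e x B.
Proof. by move=> mB; apply: mass1_setC => //; exact: prob_kernel. Qed.

Lemma measurable_pker_integral e phi : (forall y, 0 <= phi y) ->
  measurable_fun setT phi -> measurable_fun setT (fun x => \int[e x]_y phi y).
Proof.
move=> phi0 mphi; apply: measurable_fun_integral_kernel => // U mU.
exact: measurable_kernel.
Qed.

Lemma kmeas_pres_integral e phi : kmeas_pres p e -> (forall y, 0 <= phi y) ->
  measurable_fun setT phi ->
  \int[p]_x \int[e x]_y phi y = \int[p]_y phi y.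
Proof.
move=> mpe phi0 mphi.
(* Viewing [p] as a kernel from the one-point space turns the claim into the integral formula for
   composed kernels. *)
pose l := kprobability (measurable_cst (p : pprobability X R) : measurable_fun [set: unit] _).
have <- := @integral_kcomp _ _ _ unit X X R l (kernel.kernel_snd e) tt _ phi0 mphi.
by apply: eq_measure_integral => A mA _; exact: mpe.
Qed.

Lemma kmeas_pres_null e N : kmeas_pres p e -> measurable N -> p N = 0 ->
  {ae p, forall x, e x N = 0}.
Proof.
move=> mpe mN pN.
have mf : measurable_fun setT (fun x => e x N) by exact: measurable_kernel.
have /(ae_eq_integral_abs p measurableT mf) : \int[p]_x `|e x N| = 0.
  by under eq_integral do rewrite gee0_abs//; rewrite mpe.
by apply: filterS => x; apply.
Qed.

Lemma kmeas_pres_ae e (P : X -> Prop) : kmeas_pres p e ->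
  {ae p, forall y, P y} -> {ae p, forall x, {ae e x, forall y, P y}}.
Proof.
move=> mpe [N [mN pN PN]].
by apply: filterS (kmeas_pres_null mpe mN pN) => x exN; exists N.
Qed.

(** The indicator of [B] is a.s. below [e x B] and both have integral [p B], so they agree a.s.
    Invariance thus only has to be checked at points of [B]. *)
Lemma inv_sets_subinvariant e B : kmeas_pres p e -> measurable B ->
  {ae p, forall x, B x -> e x B = 1} -> inv_sets p e B.
Proof.
move=> mpe mB eB; split => //.
have : ae_eq p setT (fun x => (\1_B x)%:E) (fun x => e x B).
  apply: ae_eq_of_le_integral => //.
  - exact/measurable_EFinP.
  - exact: measurable_kernel.
  - apply: filterS eB => x eBx _; rewrite indicE.
    have [Bx|Bx] := pselect (B x); first by rewrite mem_set//= eBx.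
    by rewrite memNset//=; exact: measure_ge0.
  - rewrite integral_indic// setIT; apply: le_lt_trans (ltry 1); exact: probability_le1.
  - by rewrite mpe// integral_indic// setIT.
by apply: filterS => x /(_ Logic.I).
Qed.

Lemma inv_sets_p_complete e : kmeas_pres p e ->
  p_complete_subsigma p (inv_sets p e).
Proof.
move=> mpe; split; [split| |].
- by split => //; apply: aeW => x; rewrite measure0 indic0.
- move=> B [mB eB]; rewrite setTD; split; first exact: measurableC.
  apply: filterS eB => x eB; rewrite pker_setC// eB !indicE in_setC.
  by case: (x \in B) => //=; rewrite ?subee ?sube0.
(* A point of the union lies in some [F n], which already has full [e x]-mass. *)
- move=> F IF; apply: inv_sets_subinvariant => //.
    by apply: bigcupT_measurable => n; case: (IF n).
  have mF n : measurable (F n) by case: (IF n).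
  have := ae_foralln (fun n => (IF n).2).
  apply: filterS => x eF [n _ Fnx]; apply/eqP; rewrite eq_le pker_le1/=; last first.
    exact: bigcupT_measurable.
  have <- : e x (F n) = 1 by rewrite eF indicE mem_set.
  by apply: le_measure; rewrite ?inE//; [exact: bigcupT_measurable|exact: bigcup_sup].
- by move=> B [].
- move=> A mA pA; apply: inv_sets_subinvariant => //.
  by exists A; split => // x /= /not_implyP[].
Qed.

Lemma inv_sets_kae e e' : kae p (fun x C => e x C) (fun x C => e' x C) ->
  inv_sets p e `<=` inv_sets p e'.
Proof.
move=> ee' B [mB eB]; split => //.
by apply: filterS2 ee' eB => x <-.
Qed.

(** The function [maxe g q] is a.s. equal to its image under [e]. At a point with [g x <= q] its
    [e x]-mean is therefore [q], which is also a lower bound for it, so it equals [q] for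
    [e x]-almost all points. *)
Lemma inv_sets_sublevel e g (q : R) : kmeas_pres p e ->
  (forall x, 0 <= g x <= 1) -> measurable_fun setT g ->
  {ae p, forall x, \int[e x]_y g y = g x} ->
  inv_sets p e [set x | g x <= q%:E].
Proof.
move=> mpe g01 mg eg.
(* For negative [q] the set is empty; otherwise [maxe g q] is nonnegative. *)
have [q0|q0] := leP 0%R q; last first.
  rewrite [X in inv_sets _ _ X](_ : _ = set0).
    by case: (inv_sets_p_complete mpe) => -[].
  apply/seteqP; split => x //=; apply/negP; rewrite -ltNge.
  by case/andP: (g01 x) => + _; apply: lt_le_trans; rewrite lte_fin.
pose phi x := maxe (g x) q%:E.
have phi0 x : 0 <= phi x by rewrite le_max lee_fin q0 orbT.
have mphi : measurable_fun setT phi by exact: measurable_maxe.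
have phi_ub x : phi x <= (1 + q)%:E.
  rewrite ge_max; case/andP: (g01 x) => _ gx1; rewrite lee_fin lerDr ler01 andbT.
  by rewrite (le_trans gx1)// lee_fin lerDl.
have phi_fin (P : probability X R) : \int[P]_x phi x < +oo.
  apply: (@le_lt_trans _ _ (\int[P]_x (1 + q)%:E)).
    by apply: ge0_le_integral => // x _; rewrite lee_fin addr_ge0.
  by rewrite integral_cst// [X in _ * X]probability_setT mule1 ltry.
have ephi : ae_eq p setT phi (fun x => \int[e x]_y phi y).
  apply: ae_eq_of_le_integral => //.
  - exact: measurable_pker_integral.
  - by move=> x _; exact: integral_ge0.
  - apply: filterS eg => x egx _; rewrite ge_max -{1}egx; apply/andP; split.
      apply: ge0_le_integral => //; first by move=> y _; case/andP: (g01 y).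
      by move=> y _; rewrite le_max lexx.
    have <- : \int[e x]_y (cst q%:E) y = q%:E.
      by rewrite integral_cst// prob_kernel mule1.
    apply: ge0_le_integral => //.
    by move=> y _; rewrite le_max lexx orbT.
  - exact: phi_fin.
  - by rewrite kmeas_pres_integral.
have mB : measurable [set x | g x <= q%:E].
  by rewrite -[X in measurable X]setTI; exact: emeasurable_fun_infty_c.
apply: inv_sets_subinvariant => //.
apply: filterS ephi => x /(_ Logic.I) ephix gxq.
have {}ephix : \int[e x]_y phi y = q%:E.
  by rewrite -ephix /phi; apply/max_idPr.
have : ae_eq (e x) setT (cst q%:E) phi.
  apply: ae_eq_of_le_integral => //.
  - by apply: aeW => y _; rewrite /phi le_max lexx orbT.
  - by rewrite integral_cst// prob_kernel mule1 ltry.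
  - by rewrite integral_cst// prob_kernel mule1 ephix.
move=> [N [mN eN PN]]; apply/eqP; rewrite eq_le pker_le1//=.
have <- : e x (~` N) = 1 by rewrite pker_setC// eN sube0.
apply: le_measure; rewrite ?inE//; first exact: measurableC.
move=> y Ny /=; apply: contrapT => gyq; apply: Ny; apply: PN => /= /(_ Logic.I).
rewrite /phi => qphi; apply: gyq; rewrite qphi.
by rewrite le_max lexx.
Qed.

Lemma inv_sets_preimage e g : kmeas_pres p e ->
  (forall x, 0 <= g x <= 1) -> measurable_fun setT g ->
  {ae p, forall x, \int[e x]_y g y = g x} ->
  forall Y, measurable Y -> inv_sets p e (g @^-1` Y).
Proof.
move=> mpe g01 mg eg Y mY.
have [sI _ _] := inv_sets_p_complete mpe.
suff mgI : @measurable_fun _ _ (g_sigma_algebraType (inv_sets p e)) _ setT g.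
  have := mgI measurableT _ mY.
  by rewrite setTI /measurable/= sigma_algebra_id.
apply: (measurability _ (ErealGenOInfty.measurableE R)) => //.
move=> _ [_ [r ->] <-]; rewrite setTI.
rewrite [X in measurable X](_ : _ = ~` [set x | g x <= r%:E]).
  apply: measurableC; apply: sub_sigma_algebra.
  exact: inv_sets_sublevel.
apply/seteqP; split => x /=; rewrite in_itv/= andbT ltNge.
  by move=> /negP.
by move=> /negP.
Qed.

(** For a.a. [x], every rational sublevel set of [g] has [e x]-mass 1 or 0 according to whether it
    contains [x]. Hence [g] is [e x]-a.s. equal to [g x]. *)
Lemma inv_sets_measurable_integral e g :
  (forall x, 0 <= g x <= 1) -> measurable_fun setT g ->
  (forall Y, measurable Y -> inv_sets p e (g @^-1` Y)) ->
  {ae p, forall x, \int[e x]_y g y = g x}.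
Proof.
move=> g01 mg Ig.
have mS (r : R) : measurable [set x | g x <= r%:E].
  by rewrite -[X in measurable X]setTI; exact: emeasurable_fun_infty_c.
pose S (r : rat) := [set y | g y <= (ratr r : R)%:E].
have /ae_forall_countable : forall r,
    {ae p, forall x, e x (S r) = (\1_(S r) x)%:E}.
  move=> r; have -> : S r =
      g @^-1` `]-oo, (ratr r : R)%:E]%classic.
    by apply/seteqP; split => y /=; rewrite in_itv.
  by case: (Ig `]-oo, (ratr r : R)%:E]%classic (emeasurable_itv _)).
apply: filterS => x exS.
have gfin y : g y \is a fin_num.
  case/andP: (g01 y) => g0 g1; rewrite ge0_fin_numE//.
  by rewrite (le_lt_trans g1) ?ltry.
have : {ae e x, forall y, forall r : rat, (g y <= (ratr r : R)%:E) = (g x <= (ratr r : R)%:E)}.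
  apply: ae_forall_countable => r.
  have := exS r; rewrite indicE; have [gxr|gxr] := boolP (g x <= (ratr r : R)%:E).
    rewrite mem_set//= => /(mass1_ae (mS _) (prob_kernel _)).
    by apply: filterS.
  rewrite memNset//=; last exact/negP.
  move=> e0; exists (S r); split => //; first exact: mS.
  by move=> y /= /eqP; rewrite negb_eqb addbF.
move=> eg; have : ae_eq (e x) setT g (cst (g x)).
  apply: filterS eg => y gxy _ /=.
  (* Two distinct values of [g] would be separated by a rational. *)
  have rat_sep a b : (forall r : rat, (g a <= (ratr r : R)%:E) = (g b <= (ratr r : R)%:E)) ->
      ~~ (g a < g b).
    move=> ab; apply/negP; rewrite -(fineK (gfin a)) -(fineK (gfin b)) lte_fin.
    move=> /rat_in_itvoo[r]; rewrite in_itv/= => /andP[ar rb].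
    have := ab r; rewrite -(fineK (gfin a)) -(fineK (gfin b)) !lee_fin.
    by rewrite (ltW ar) leNgt rb.
  apply/eqP; rewrite eq_le !leNgt !rat_sep//.
move=> gE; rewrite (ae_eq_integral (cst (g x)))//.
by rewrite integral_cst// prob_kernel mule1.
Qed.

End measure_preserving_kernels.

(** On [B] the inequality between the functions is opposite to that between their integrals, so they
    agree a.e. there; and [B] contains every point where the conclusion fails. *)
Lemma ae_le_of_integral_le (d : measure_display) (T : measurableType d)
    (R : realType) (mu : {measure set T -> \bar R}) (f g : T -> \bar R)
    (B := [set x | g x <= f x]) :
  measurable_fun setT f -> measurable_fun setT g ->
  (forall x, 0 <= f x) -> (forall x, 0 <= g x) ->
  \int[mu]_(x in B) g x < +oo ->
  \int[mu]_(x in B) f x <= \int[mu]_(x in B) g x ->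
  {ae mu, forall x, f x <= g x}.
Proof.
move=> mf mg f0 g0 goo fg.
have mB : measurable B by rewrite -[B]setTI; exact: measurable_lee.
have : ae_eq mu B g f.
  apply: ae_eq_of_le_integral => //.
  - exact: measurable_funS mg.
  - exact: measurable_funS mf.
  - exact: aeW.
apply: filterS => x gfx; rewrite leNgt; apply/negP => gf.
by move: (gf); rewrite gfx ?ltxx//; exact: ltW.
Qed.

(* The canonical instance leaves the measurability of [f] as an unresolved
   argument, so it is supplied here by name. *)
Definition mpushforward (d d' : measure_display) (T : measurableType d)
    (U : measurableType d') (R : realType) (m : {measure set T -> \bar R})
    (f : T -> U) (mf : measurable_fun setT f) : {measure set U -> \bar R} :=
  measure_function_pushforward__canonical__measure_function_Measure m mf.

(** * Finite measures on the extended reals are determined by rational rays *)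

Section ereal_measures.
Context (R : realType).

(** A countable generating family closed under intersection. The whole space is included so that the
    family covers the extended line by one of its members. *)
Definition rat_rays : set (set (\bar R)) :=
  [set A | A = setT \/ exists q : rat, A = [set x | x < (ratr q)%:E]].

Lemma measurable_rat_rays : @measurable _ (\bar R) = <<s rat_rays >>.
Proof.
apply/seteqP; split.
  rewrite [X in X `<=` _](_ : _ = emeasurable (@ocitv R))//.
  rewrite ErealGenInftyO.measurableE.
  apply: smallest_sub; first exact: smallest_sigma_algebra.
  move=> _ [r ->].
  rewrite [X in smallest _ _ X](_ : _ = \bigcup_(q : rat)
      (if (ratr q < r)%R then [set x | x < (ratr q)%:E] else set0)).
    apply: (@bigcupT_measurable_rat _ (g_sigma_algebraType rat_rays)) => q.
    by case: ifPn => // _; apply: sub_sigma_algebra; right; exists q.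
  apply/seteqP; split => x /=; rewrite in_itv/=.
    case: x => [x| |] //=.
    - rewrite lte_fin => /rat_in_itvoo[q]; rewrite in_itv/= => /andP[xq qr].
      by exists q => //; rewrite qr /= lte_fin.
    - have /rat_in_itvoo[q] : (r - 1 < r)%R by rewrite ltrBlDr ltrDl.
      rewrite in_itv/= => /andP[_ qr] _.
      by exists q => //; rewrite qr /= ltNyr.
  move=> [q _]; case: ifPn => // qr /= /lt_trans; apply.
  by rewrite lte_fin.
apply: smallest_sub; first exact: sigma_algebra_measurable.
move=> _ [->//|[q ->]].
by rewrite -[X in measurable X]setTI; exact: emeasurable_fun_infty_o.
Qed.

Lemma measure_unique_rat_rays (m1 m2 : {measure set (\bar R) -> \bar R}) :
  m1 setT < +oo -> m1 setT = m2 setT ->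
  (forall q : rat, m1 [set x | x < (ratr q)%:E] = m2 [set x | x < (ratr q)%:E]) ->
  forall A, measurable A -> m1 A = m2 A.
Proof.
move=> m1oo m12T m12 A mA.
apply: (measure_unique rat_rays (fun=> setT)) => //.
- exact: measurable_rat_rays.
- move=> _ _ [->|[q ->]] [->|[r ->]]; rewrite ?setIT ?setTI; [by left|by right; exists r|by right; exists q|right].
  exists (Order.min q r); apply/seteqP; split => x /=.
    by move=> [xq xr]; case: (leP q r).
  case: (leP q r) => qr xq; split => //; apply: lt_le_trans xq _;
    rewrite lee_fin ler_rat//; exact: ltW.
- by move=> n; left.
- by rewrite bigcup_const.
- by move=> _ [->//|[q ->]].
Qed.

End ereal_measures.

(** * Standard Borel spaces as measurable retracts of the extended reals *)

Section standard_borel_spaces.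
Context (d : measure_display) (X : measurableType d) (R : realType).

(** [g] inverts the embedding on its range and is [x0] elsewhere; it is measurable because the
    embedding maps measurable sets to measurable sets. Measures can thus be moved to the extended
    reals and back. *)
Lemma standard_borel_retract (x0 : X) : @standard_borel d X R ->
  exists (F : X -> \bar R) (g : \bar R -> X),
    [/\ measurable_fun setT F, measurable_fun setT g & cancel F g].
Proof.
move=> [f [f_inj mf mrf mimf]].
pose g (z : \bar R) : X :=
  if pselect (exists x, (f x)%:E = z) is left ex then sval (cid ex) else x0.
have Fg : cancel (EFin \o f) g.
  move=> x; rewrite /g /=; case: pselect => [ex|]; last by case; exists x.
  by case: cid => y /= [] /f_inj.
exists (EFin \o f), g; split => //; first exact/measurable_EFinP.
move=> _ A mA; rewrite setTI.
have mimF B : measurable B -> measurable ((EFin \o f) @` B).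
  by move=> mB; rewrite -image_comp; apply: measurable_image_EFin; exact: mimf.
have Fim B : (EFin \o f) @` B = g @^-1` B `&` range (EFin \o f).
  apply/seteqP; split => z.
    by move=> [x Bx <-]; split; [by rewrite /preimage /mkset Fg|exists x].
  by move=> [Bz [x _ xz]]; exists x => //; move: Bz; rewrite -xz /preimage /mkset Fg.
have gN z : ~ range (EFin \o f) z -> g z = x0.
  by move=> nz; rewrite /g; case: pselect => // -[x xz]; case: nz; exists x.
(* The preimage of [A] contains the complement of the range if [x0] is in [A] and misses it
   otherwise. *)
have [Ax0|Ax0] := pselect (A x0).
  rewrite [X in measurable X](_ : _ = (EFin \o f) @` A `|` ~` range (EFin \o f)).
    apply: measurableU; first exact: mimF.
    by apply: measurableC; exact: mimF.
  rewrite (Fim A); apply/seteqP; split => z.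
    by move=> Agz; have [rz|nrz] := pselect (range (EFin \o f) z); [left; split|right].
  by move=> [[]//|/gN]; rewrite /preimage /mkset => ->.
rewrite [X in measurable X](_ : _ = (EFin \o f) @` A); first exact: mimF.
rewrite (Fim A); apply/seteqP; split => z; last by case.
move=> Agz; split => //; apply: contrapT => /gN gz.
by apply: Ax0; rewrite -gz.
Qed.

(** The exceptional null set in the hypothesis depends on [C]. Only the preimages of countably many
    rays are used, so one null set serves for all of them, and they determine both measures. *)
Lemma kae_setwise (p : probability X R)
    (mu nu : X -> {measure set X -> \bar R}) : @standard_borel d X R ->
  (forall x, mu x setT = 1) -> (forall x, nu x setT = 1) ->
  (forall C, measurable C -> {ae p, forall x, mu x C = nu x C}) ->
  kae p (fun x C => mu x C) (fun x C => nu x C).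
Proof.
move=> hX mu1 nu1 munu.
have [[x0 _]|X0] := pselect (exists x : X, True); last first.
  by apply: aeW => x; case: X0; exists x.
have [F [g [mF mg Fg]]] := standard_borel_retract x0 hX.
have : {ae p, forall x, forall q : rat, mu x (F @^-1` [set z | z < (ratr q)%:E]) =
    nu x (F @^-1` [set z | z < (ratr q)%:E])}.
  apply: ae_forall_countable => q; apply: munu.
  by rewrite -[X in measurable X]setTI; exact: emeasurable_fun_infty_o.
apply: filterS => x munux C mC.
(* Every measurable [C] is a preimage under [F], so it suffices to compare the push-forwards by
   [F]. *)
have FC : C = F @^-1` (g @^-1` C).
  by apply/seteqP; split => y; rewrite /preimage/= Fg.
rewrite FC.
apply: (measure_unique_rat_rays (m1 := mpushforward (mu x) mF)
    (m2 := mpushforward (nu x) mF)) => //.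
- by rewrite [ltLHS](mu1 x) ltry.
- by rewrite [LHS](mu1 x) [RHS](nu1 x).
- by rewrite -[X in measurable X]setTI; exact: mg.
Qed.

End standard_borel_spaces.

(** * Regular conditional probabilities, idempotents and the order *)

Section regular_conditional_probabilities.
Context (d : measure_display) (X : measurableType d) (R : realType).
Variable p : probability X R.
Implicit Types (e k l : R.-pker X ~> X) (phi g : X -> \bar R).

(** Both functions are measurable on [X] equipped with [G] alone, where the general comparison
    result applies. *)
Lemma subsigma_setle (G : set (set X)) f g : sigma_algebra setT G ->
  (forall Y, measurable Y -> G (f @^-1` Y)) ->
  (forall Y, measurable Y -> G (g @^-1` Y)) -> G [set x | g x <= f x].
Proof.
move=> sG Gf Gg.
have mG h : (forall Y, measurable Y -> G (h @^-1` Y)) ->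
    @measurable_fun _ _ (g_sigma_algebraType G) (\bar R) setT h.
  by move=> Gh _ Y mY; rewrite setTI; apply: sub_sigma_algebra; exact: Gh.
have := @measurable_lee _ (g_sigma_algebraType G) R setT measurableT _ _ (mG _ Gg) (mG _ Gf).
by rewrite setTI /measurable/= sigma_algebra_id.
Qed.

(** Uniqueness of conditional expectations: the sets where one function dominates the other lie in
    [G], so the integrals may be compared on them. *)
Lemma subsigma_ae_eq (G : set (set X)) f g :
  sigma_algebra setT G -> G `<=` measurable ->
  (forall x, 0 <= f x) -> (forall x, 0 <= g x) ->
  (forall Y, measurable Y -> G (f @^-1` Y)) ->
  (forall Y, measurable Y -> G (g @^-1` Y)) ->
  \int[p]_x f x < +oo ->
  (forall B, G B -> \int[p]_(x in B) f x = \int[p]_(x in B) g x) ->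
  {ae p, forall x, f x = g x}.
Proof.
move=> sG Gm f0 g0 Gf Gg foo fg.
have mG (h : X -> \bar R) :
    (forall Y, measurable Y -> G (h @^-1` Y)) -> measurable_fun setT h.
  by move=> Gh _ Y mY; rewrite setTI; apply: Gm; exact: Gh.
have mf := mG _ Gf; have mg := mG _ Gg.
have fB B : G B -> \int[p]_(x in B) f x < +oo.
  move=> GB; apply: le_lt_trans foo; apply: ge0_subset_integral => //.
  exact: Gm.
have GT : G setT by case: sG => G0 GC _; rewrite -(setD0 setT); exact: GC.
have Gfg := subsigma_setle sG Gf Gg.
have Ggf := subsigma_setle sG Gg Gf.
have le1 : {ae p, forall x, f x <= g x}.
  by apply: ae_le_of_integral_le; rewrite // -?fg//; exact: fB.
have le2 : {ae p, forall x, g x <= f x}.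
  by apply: ae_le_of_integral_le; rewrite // -?fg//; exact: fB.
by apply: filterS2 le1 le2 => x *; apply/eqP; rewrite eq_le; apply/andP.
Qed.

Lemma pker_ge0_le1 e A : measurable A -> forall x, 0 <= e x A <= 1.
Proof. by move=> mA x; rewrite measure_ge0 pker_le1. Qed.

Lemma pker_integral_lty e A : measurable A -> \int[p]_x e x A < +oo.
Proof.
move=> mA; apply: (@le_lt_trans _ _ (\int[p]_x (cst 1) x)).
  by apply: ge0_le_integral => //; [exact: measurable_kernel|move=> x _; exact: pker_le1].
by rewrite integral_cst// [X in _ * X]probability_setT mule1 ltry.
Qed.

Lemma is_rcp_unique (G : set (set X)) e e' : @standard_borel d X R ->
  sigma_algebra setT G -> G `<=` measurable -> is_rcp p G e -> is_rcp p G e' ->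
  kae p (fun x C => e x C) (fun x C => e' x C).
Proof.
move=> hX sG Gm re re'; apply: kae_setwise => //.
- by move=> x; exact: prob_kernel.
- by move=> x; exact: prob_kernel.
move=> C mC; have [Ge ie] := re _ mC; have [Ge' ie'] := re' _ mC.
apply: (subsigma_ae_eq sG) => //; first exact: pker_integral_lty.
by move=> B GB; rewrite ie// ie'.
Qed.

(** For a.a. [x] the measure [e x] is carried by [B] or by its complement, according to where [x]
    lies. So restricting to [B] commutes a.s. with the action of [e], which preserves integrals. *)
Lemma inv_sets_integral e phi B : kmeas_pres p e -> (forall x, 0 <= phi x) ->
  measurable_fun setT phi -> inv_sets p e B ->
  \int[p]_(x in B) \int[e x]_y phi y = \int[p]_(x in B) phi x.
Proof.
move=> mpe phi0 mphi [mB eB].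
rewrite integral_mkcond [RHS]integral_mkcond.
have mphiB : measurable_fun setT (phi \_ B).
  by apply/(measurable_restrictT _ _).1 => //; exact: measurable_funS mphi.
have phiB0 x : 0 <= (phi \_ B) x by exact: erestrict_ge0.
rewrite -[RHS](kmeas_pres_integral mpe phiB0 mphiB).
apply: ge0_ae_eq_integral => //.
- apply/(measurable_restrictT _ _).1 => //.
  by apply: (measurable_funS measurableT) => //; exact: measurable_pker_integral.
- exact: measurable_pker_integral.
- by move=> x _; apply: erestrict_ge0 => y _; exact: integral_ge0.
- by move=> x _; exact: integral_ge0.
apply: filterS eB => x eBx _; rewrite patchE.
rewrite -integral_mkcond.
case: ifPn => [xB|xB]; last first.
  rewrite null_set_integral//; first exact: measurable_funS mphi.
  by rewrite [LHS]eBx indicE (negbTE xB).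
rewrite -[X in \int[_]_(_ in X) _ = _](setUv B) ge0_integral_setU//; last 3 first.
- exact: measurableC.
- by rewrite setUv.
- by apply/disj_set2P; rewrite setICr.
rewrite [X in _ + X]null_set_integral ?adde0//; first exact: measurableC.
  exact: measurable_funS mphi.
by rewrite [LHS]pker_setC// eBx indicE xB subee.
Qed.

Lemma mp_idem_rcp e : mp_idem p e -> is_rcp p (inv_sets p e) e.
Proof.
move=> [mpe ie] A mA.
have me : measurable_fun setT (fun x => e x A) by exact: measurable_kernel.
split.
  apply: inv_sets_preimage => //; first exact: pker_ge0_le1.
  by apply: filterS ie => x; exact.
move=> B IB; have [mB _] := IB.
transitivity (\int[p]_(x in B) (\1_A x)%:E); last by rewrite integral_indic.
rewrite -(inv_sets_integral (phi := EFin \o \1_A) mpe)//; last first.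
  exact/measurable_EFinP.
  by move=> x; rewrite /= lee_fin.
by apply: eq_integral => x _; rewrite integral_indic// setIT.
Qed.

Lemma kcomp_setwise l k : @standard_borel d X R ->
  forall e, (forall C, measurable C -> {ae p, forall x, kcomp_ l k x C = e x C}) ->
  kae p (kcomp_ l k) (fun x C => e x C).
Proof.
move=> hX e lke; apply: (@kae_setwise _ _ _ p (mkcomp_ l k)) => //.
- move=> x; transitivity (\int[k x]_y (cst 1) y).
    by apply: eq_integral => y _; exact: prob_kernel.
  by rewrite integral_cst// prob_kernel mule1.
- by move=> x; exact: prob_kernel.
Qed.

Lemma rcp_meas_pres (G : set (set X)) e : sigma_algebra setT G ->
  is_rcp p G e -> kmeas_pres p e.
Proof.
move=> [G0 GC _] re A mA; have [_ ->] := re _ mA; first by rewrite setIT.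
by rewrite -(setD0 setT); exact: GC.
Qed.

(** The integral of [e x B] over [B] is [p B], while the integrand is at most 1; so it is 1 a.s. on
    [B]. *)
Lemma rcp_sub_inv_sets (G : set (set X)) e : sigma_algebra setT G ->
  G `<=` measurable -> is_rcp p G e -> G `<=` inv_sets p e.
Proof.
move=> sG Gm re B GB; have mB := Gm _ GB.
apply: inv_sets_subinvariant => //; first exact: rcp_meas_pres re.
have : ae_eq p B (fun x => e x B) (cst 1).
  apply: ae_eq_of_le_integral => //.
  - by apply: measurable_funTS; exact: measurable_kernel.
  - by apply: aeW => x _; exact: pker_le1.
  - apply: le_lt_trans (pker_integral_lty e mB).
    by apply: ge0_subset_integral => //; exact: measurable_kernel.
  - by have [_ ->//] := re _ mB; rewrite setIid integral_cst// mul1e.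
by apply: filterS => x; exact.
Qed.

Lemma rcp_mp_idem (G : set (set X)) e : @standard_borel d X R ->
  p_complete_subsigma p G -> is_rcp p G e -> mp_idem p e.
Proof.
move=> hX [sG Gm _] re; have mpe := rcp_meas_pres sG re.
have GI := rcp_sub_inv_sets sG Gm re.
split => //; apply: kcomp_setwise => // C mC.
apply: (@inv_sets_measurable_integral _ _ _ p e (fun y => e y C)).
- exact: pker_ge0_le1.
- exact: measurable_kernel.
- by move=> Y mY; apply: GI; case: (re _ mC) => + _; exact.
Qed.

(** An invariant [B] differs by a null set from [B'], the set where [e x B] is 1, which lies in [G];
    completeness then puts [B] itself in [G]. *)
Lemma inv_sets_rcp (G : set (set X)) e :
  p_complete_subsigma p G -> is_rcp p G e -> inv_sets p e = G.
Proof.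
move=> [sG Gm Gp] re; apply/seteqP; split; last exact: rcp_sub_inv_sets.
move=> B [mB eB].
pose B' := (fun x => e x B) @^-1` [set 1].
have GB' : G B' by case: (re _ mB) => + _; apply; exact: emeasurable_set1.
have mB' := Gm _ GB'.
have BB' : {ae p, forall x, B x <-> B' x}.
  apply: filterS eB => x; rewrite /B' /preimage /= indicE => ->.
  split=> [Bx|]; first by rewrite mem_set.
  have [//|Bx] := pselect (B x); rewrite memNset// => -[] /eqP.
  by rewrite eq_sym oner_eq0.
have null A : measurable A -> (forall x, A x -> ~ (B x <-> B' x)) -> G A.
  move=> mA AB; apply: Gp => //; apply/negligibleP => //.
  by apply: negligibleS BB' => x /= Ax; exact: AB.
have sGT : <<s G >> = G by exact: sigma_algebra_id.
pose T := g_sigma_algebraType G.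
have mT (A : set X) : G A <-> @measurable _ T A by rewrite /measurable/= sGT.
have -> : B = (B' `\` (B' `\` B)) `|` (B `\` B').
  by rewrite setDD setIC setUIDK.
apply/mT; apply: (@measurableU _ T); [apply: (@measurableD _ T)|]; apply/mT => //.
  by apply: null; [exact: measurableD|move=> x [B'x Bx] [_ /(_ B'x)]].
by apply: null; [exact: measurableD|move=> x [Bx B'x] [/(_ Bx)]].
Qed.

(** As [e2] respects null sets, for a.a. [x] the function [e1 y B] of [y] is [e2 x]-a.s. the
    indicator of [B]. Its [e2 x]-mean is then [e2 x B], and it is [e1 x B] by the order relation. *)
Lemma kle_inv_sets e1 e2 : kmeas_pres p e2 -> kle p e1 e2 ->
  inv_sets p e1 `<=` inv_sets p e2.
Proof.
move=> mp2 [e12 _] B [mB eB]; split => //.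
apply: filterS3 e12 (kmeas_pres_ae mp2 eB) eB => x e12x e2B <-.
rewrite -e12x// /kcomp_ (ae_eq_integral (fun y => (\1_B y)%:E))//.
- by rewrite integral_indic// setIT.
- exact: measurable_kernel.
- exact/measurable_EFinP.
- by apply: filterS e2B => y.
Qed.

Lemma inv_sets_kle e1 e2 : @standard_borel d X R -> mp_idem p e1 -> mp_idem p e2 ->
  inv_sets p e1 `<=` inv_sets p e2 -> kle p e1 e2.
Proof.
move=> hX mi1 mi2 I12; have [mp1 id1] := mi1; have [mp2 _] := mi2.
have [sI1 Im1 _] := inv_sets_p_complete mp1.
split; apply: kcomp_setwise => // C mC; have [I1C iC] := mp_idem_rcp mi1 mC.
  (* Measurability for the invariant sets of [e1] passes to those of [e2], so [e2] fixes
     [e1 y C]. *)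
  apply: (@inv_sets_measurable_integral _ _ _ p e2 (fun y => e1 y C)).
  - exact: pker_ge0_le1.
  - exact: measurable_kernel.
  - by move=> Y mY; apply: I12; exact: I1C.
(* The other composite is the tower property: [h] and [e1 x C] are both measurable for the invariant
   sets of [e1] and have equal integrals over them. *)
have m2 : measurable_fun setT (fun y => e2 y C) by exact: measurable_kernel.
pose h x := \int[e1 x]_y e2 y C.
have h0 x : 0 <= h x by exact: integral_ge0.
have mh : measurable_fun setT h by exact: measurable_pker_integral.
have h1 x : h x <= 1.
  have <- : \int[e1 x]_y (cst 1) y = 1 by rewrite integral_cst// prob_kernel mule1.
  by apply: ge0_le_integral => // y _; exact: pker_le1.
have eh : {ae p, forall x, \int[e1 x]_y h y = h x}.
  apply: filterS id1 => x id1x; rewrite /h -integral_mkcomp_//.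
  by apply: eq_measure_integral => A mA _; exact: id1x.
have Ih : forall Y, measurable Y -> inv_sets p e1 (h @^-1` Y).
  by apply: inv_sets_preimage => // x; rewrite h0 h1.
apply: (subsigma_ae_eq sI1 Im1) => //.
  by rewrite kmeas_pres_integral//; exact: pker_integral_lty.
move=> B IB; rewrite inv_sets_integral// iC//.
by have [_ ->//] := mp_idem_rcp mi2 mC; exact: I12.
Qed.

End regular_conditional_probabilities.

(** * Kernels given by the law of a random map *)

Section random_map_kernel.
Context (d d' d'' : measure_display) (T : measurableType d)
  (U : measurableType d') (Y : measurableType d'') (R : realType).
Variables (m : probability U R) (Z : T * U -> Y).
Hypothesis mZ : measurable_fun setT Z.

Definition random_map_kernel (t : T) : {measure set Y -> \bar R} :=
  mpushforward m (measurable_fun_pair2 t mZ).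

(** In this form measurability in [t] is that of the measure of sections. *)
Lemma random_map_kernelE t C :
  random_map_kernel t C = m (xsection (Z @^-1` C) t).
Proof. by rewrite xsectionE. Qed.

Let measurable_random_map_kernel C : measurable C ->
  measurable_fun setT (random_map_kernel ^~ C).
Proof.
move=> mC; under eq_fun do rewrite random_map_kernelE.
apply: (measurable_fun_xsection m).
by rewrite -[X in measurable X]setTI; exact: mZ.
Qed.

HB.instance Definition _ :=
  isKernel.Build _ _ _ _ _ random_map_kernel measurable_random_map_kernel.

Let random_map_kernelT t : random_map_kernel t setT = 1.
Proof. exact: probability_setT. Qed.

HB.instance Definition _ :=
  Kernel_isProbability.Build _ _ _ _ _ random_map_kernel random_map_kernelT.

End random_map_kernel.

(** * The uniform distribution *)

Section unit_interval.
Context (R : realType).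

(** The uniform law on the unit interval, kept as a measure on all of [R] to avoid a subtype. *)
Definition unit_interval_measure :=
  mrestr (@lebesgue_measure R) (measurable_itv `[0%R, 1%R]).

HB.instance Definition _ := Measure.on unit_interval_measure.

Let unit_interval_measure_setT : unit_interval_measure setT = 1.
Proof.
by rewrite /unit_interval_measure /mrestr setTI lebesgue_measure_itv/= lte_fin ltr01 oppr0 adde0.
Qed.

HB.instance Definition _ :=
  Measure_isProbability.Build _ _ _ unit_interval_measure unit_interval_measure_setT.

Lemma unit_interval_measure_le (h : \bar R) : 0 <= h <= 1 ->
  unit_interval_measure [set u | u%:E <= h] = h.
Proof.
case: h => [h| |] /andP[]; rewrite ?leye_eq ?leeNy_eq// !lee_fin => h0 h1.
rewrite /unit_interval_measure /mrestr [X in lebesgue_measure X](_ : _ = `[0%R, h]%classic).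
  rewrite lebesgue_measure_itv/= lte_fin; case: ltP => h0'; first by rewrite oppr0 adde0.
  by congr (_%:E); apply/eqP; rewrite eq_le h0 h0'.
apply/seteqP; split => u /=; rewrite !in_itv/= lee_fin.
  by move=> [-> /andP[->]].
by move=> /andP[-> uh]; rewrite uh (le_trans uh).
Qed.

End unit_interval.

Section finite_measure_of_measure.
Context (d : measure_display) (T : measurableType d) (R : realType).
Variable m : {measure set T -> \bar R}.

(* The finiteness proof is an argument so that instance resolution can use it. *)
Definition mfinite (mfin : fin_num_fun m) : set T -> \bar R := m.

Variable mfin : fin_num_fun m.

HB.instance Definition _ := Measure.on (mfinite mfin).

HB.instance Definition _ := Measure_isFinite.Build _ _ _ (mfinite mfin) mfin.

End finite_measure_of_measure.

(** * Conditional probabilities and conditional quantiles given a map [phi] *)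

Section conditional_distribution.
Context (d d' : measure_display) (X : measurableType d) (T : measurableType d')
  (R : realType).
Variables (p : probability X R) (phi : X -> T) (F : X -> \bar R).
Hypotheses (mphi : measurable_fun setT phi) (mF : measurable_fun setT F).

(** [H] is the Radon-Nikodym derivative, on [T], of the push-forward of [p] restricted to [A] with
    respect to that of [p]. *)
Lemma conditional_probability_exists (A : set X) : measurable A ->
  exists H : T -> \bar R, [/\ measurable_fun setT H, forall t, 0 <= H t &
    forall B, measurable B ->
      \int[p]_(x in phi @^-1` B) H (phi x) = p (A `&` phi @^-1` B)].
Proof.
move=> mA.
have mphiB B : measurable B -> measurable (phi @^-1` B).
  by move=> mB; rewrite -[X in measurable X]setTI; exact: mphi.
pose mu : {measure set T -> \bar R} := mpushforward p mphi.
pose nu : {measure set T -> \bar R} := mpushforward (mrestr p mA) mphi.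
have mu_fin : fin_num_fun mu.
  by move=> B mB; rewrite fin_num_measure//; exact: mphiB.
have nu_fin : fin_num_fun nu.
  move=> B mB; rewrite [X in X \is a fin_num](_ : _ = p (phi @^-1` B `&` A))//.
  by rewrite fin_num_measure//; apply: measurableI => //; exact: mphiB.
pose mu' : {finite_measure set T -> \bar R} := mfinite mu_fin.
pose nu' : {finite_measure set T -> \bar R} := mfinite nu_fin.
have dom : nu' `<< mu'.
  move=> B muB C mC CB; apply/eqP; rewrite -measure_le0 -(muB _ mC CB).
  apply: le_measure; rewrite ?inE; [|exact: mphiB|exact: subIsetl].
  by apply: measurableI => //; exact: mphiB.
have [H [H0 iH HE]] := radon_nikodym_finite dom.
have mH : measurable_fun setT H by exact: measurable_int iH.
exists H; split => // B mB.
rewrite setIC -[RHS]/(nu' B) HE//.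
rewrite -(ge0_integral_pushforward mphi p mB (f := H))//.
exact: measurable_funTS.
Qed.

Let ray (q : rat) : set (\bar R) := [set z | z < (ratr q)%:E].

Let mray q : measurable (ray q).
Proof. by rewrite -[X in measurable X]setTI; exact: emeasurable_fun_infty_o. Qed.

Let mFray q : measurable (F @^-1` ray q).
Proof. by rewrite -[X in measurable X]setTI; exact: mF. Qed.

Let mphiB B : measurable B -> measurable (phi @^-1` B).
Proof. by move=> mB; rewrite -[X in measurable X]setTI; exact: mphi. Qed.

(** Left continuity of the distribution function of [F]: the strict ray at [q] is the increasing
    union of those at [q - 1/(n+1)]. *)
Let ray_lim (q : rat) (c : \bar R) :
  (forall r : rat, (r < q)%R -> p (F @^-1` ray r) <= c) -> p (F @^-1` ray q) <= c.
Proof.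
move=> pc; pose r n : rat := (q - n.+1%:R^-1)%R.
have rE : F @^-1` ray q = \bigcup_n F @^-1` ray (r n).
  rewrite -preimage_bigcup; congr (_ @^-1` _); apply/seteqP; split => z /=; last first.
    move=> [n _]; rewrite /ray /= => /lt_trans; apply.
    by rewrite lte_fin ltr_rat /r ltrBlDr ltrDl invr_gt0 ltr0n.
  rewrite /ray /=; case: z => [z| |] //; last first.
    by move=> _; exists 0%N => //=; rewrite ltNyr.
  rewrite lte_fin => zq.
  have [n nz] := ltr_add_invr zq.
  exists n => //=; rewrite lte_fin /r rmorphB/= fmorphV/= ratr_nat.
  by rewrite ltrBrDr.
have mr n : measurable (F @^-1` ray (r n)) by exact: mFray.
have ndr : nondecreasing_seq (fun n => F @^-1` ray (r n)).
  move=> m n mn; apply/subsetPset => x; rewrite /preimage /ray /= => /lt_le_trans; apply.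
  rewrite lee_fin ler_rat /r lerD2l lerN2 lef_pV2 ?posrE ?ltr0n//.
  by rewrite ler_nat.
have mU : measurable (\bigcup_n F @^-1` ray (r n)) by exact: bigcupT_measurable.
have cv := nondecreasing_cvg_mu (mu := p) mr mU ndr.
rewrite rE -(cvg_lim _ cv)//; apply: lime_le.
  by apply/cvg_ex; eexists; exact: cv.
apply: nearW => n; apply: pc.
by rewrite /r ltrBlDr ltrDl invr_gt0 ltr0n.
Qed.

Lemma conditional_quantile_exists : exists Q : T * R -> \bar R,
  measurable_fun setT Q /\
  forall A B, measurable A -> measurable B ->
    \int[p]_(x in phi @^-1` B) unit_interval_measure [set u | A (Q (phi x, u))]
    = p (F @^-1` A `&` phi @^-1` B).
Proof.
have [H HP] := choice (fun q => conditional_probability_exists (mFray q)).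
have mH q : measurable_fun setT (H q) by case: (HP q).
have H0 q t : 0 <= H q t by case: (HP q).
have HE q B : measurable B ->
    \int[p]_(x in phi @^-1` B) H q (phi x) = p (F @^-1` ray q `&` phi @^-1` B).
  by case: (HP q) => _ _; exact.
have mHphi q : measurable_fun setT (H q \o phi) by exact: measurableT_comp.
have HET q : \int[p]_x H q (phi x) = p (F @^-1` ray q).
  by have := HE q setT measurableT; rewrite preimage_setT setIT.
have p_lty A : measurable A -> p A < +oo.
  by move=> mA; apply: le_lt_trans (ltry 1); exact: probability_le1.
(* The infimum in the extended reals exists at every point, even where [H] is not a distribution
   function; it is [+oo] when no rational qualifies. *)
pose Q (z : T * R) := ereal_inf [set (ratr q : R)%:E | q in [set q | z.2%:E <= H q z.1]].
have QltP z (q : rat) : Q z < (ratr q)%:E <-> exists2 r, (r < q)%R & z.2%:E <= H r z.1.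
  split.
    move=> /ereal_inf_lt[_ [r zr <-]]; rewrite lte_fin ltr_rat => rq.
    by exists r.
  move=> [r rq zr]; apply/ereal_inf_ltP; exists (ratr r)%:E; last by rewrite lte_fin ltr_rat.
  by exists r.
have mS r : measurable [set z : T * R | z.2%:E <= H r z.1].
  rewrite -[X in measurable X]setTI; apply: measurable_lee => //.
    by apply/measurable_EFinP; exact: measurable_snd.
  by apply: measurableT_comp => //; exact: measurable_fst.
have mQ : measurable_fun setT Q.
  apply: (measurability _ (measurable_rat_rays R)) => // _ [_ [->|[q ->]] <-].
    by rewrite preimage_setT setIT.
  rewrite setTI [X in measurable X](_ : _ = \bigcup_(r : rat)
      (if (r < q)%R then [set z : T * R | z.2%:E <= H r z.1] else set0)).
    by apply: bigcupT_measurable_rat => r; case: ifPn.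
  apply/seteqP; split => z.
    by move=> /QltP[r rq zr]; exists r => //; rewrite rq.
  by move=> [r _]; case: ifPn => // rq zr; apply/QltP; exists r.
exists Q; split => //.
pose Qphi (z : X * R) := Q (phi z.1, z.2).
have mQphi : measurable_fun setT Qphi.
  apply: measurableT_comp => //; apply: measurable_fun_pair.
    by apply: measurableT_comp => //; exact: measurable_fst.
  exact: measurable_snd.
pose K := @random_map_kernel _ _ _ _ _ _ R (@unit_interval_measure R) _ mQphi.
have mK A : measurable A -> measurable_fun setT (K ^~ A).
  by move=> mA; exact: (measurable_kernel K).
have mHlee (f g : T -> \bar R) : measurable_fun setT f -> measurable_fun setT g ->
    measurable [set t | f t <= g t].
  by move=> mf mg; rewrite -[X in measurable X]setTI; exact: measurable_lee.
(* Monotonicity in the level and the bound by 1 hold only a.s.; both come from comparing integrals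
   over the set where the inequality could fail. *)
have Hle (r q : rat) : (r <= q)%R -> {ae p, forall x, H r (phi x) <= H q (phi x)}.
  move=> rq; have mS' := mHlee _ _ (mH q) (mH r).
  apply: (@ae_le_of_integral_le _ _ _ p (H r \o phi) (H q \o phi)) => //.
  - by move=> x; exact: H0.
  - by move=> x; exact: H0.
  - rewrite [ltLHS](HE q _ mS'); apply: p_lty.
    by apply: measurableI => //; exact: mphiB.
  - rewrite [leLHS](HE r _ mS') [leRHS](HE q _ mS').
    apply: le_measure; rewrite ?inE; [by apply: measurableI => //; exact: mphiB..|].
    apply: setSI => x; rewrite /preimage /ray /= => /lt_le_trans; apply.
    by rewrite lee_fin ler_rat.
have Hle1 q : {ae p, forall x, H q (phi x) <= 1}.
  have mS' := mHlee (cst 1) _ (measurable_cst _) (mH q).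
  apply: (@ae_le_of_integral_le _ _ _ p (H q \o phi) (cst 1)) => //.
  - by move=> x; exact: H0.
  - rewrite integral_cst ?mul1e; last exact: (mphiB mS').
    by apply: p_lty; exact: (mphiB mS').
  - rewrite [leLHS](HE q _ mS') integral_cst ?mul1e; last exact: (mphiB mS').
    apply: le_measure; rewrite ?inE; [|exact: (mphiB mS')|exact: subIsetr].
    by apply: measurableI => //; exact: mphiB.
have m_le (h : \bar R) : measurable [set u : R | u%:E <= h].
  by rewrite -[X in measurable X]setTI; exact: measurable_lee.
have KxE x A : K x A = unit_interval_measure [set u | A (Q (phi x, u))] by [].
have mKs x (A : set (\bar R)) : measurable A -> measurable [set u : R | A (Q (phi x, u))].
  move=> mA; have mQx := measurable_fun_pair2 x mQphi.
  by rewrite -[X in measurable X]setTI; exact: mQx.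
(* [Q < q] gives [u <= H r] for some [r < q], hence [u <= H q], an event of probability [H q]. *)
have KleH q : {ae p, forall x, K x (ray q) <= H q (phi x)}.
  have HH : {ae p, forall x, forall r : rat, (r <= q)%R -> H r (phi x) <= H q (phi x)}.
    apply: ae_forall_countable => r.
    have [rq|rq] := boolP (r <= q)%R; last by apply: aeW => x.
    by apply: filterS (Hle _ _ rq) => x.
  apply: filterS2 HH (Hle1 q) => x Hr Hq1.
  rewrite KxE -[leRHS]unit_interval_measure_le ?H0//.
  apply: le_measure; rewrite ?inE; [exact: mKs|exact: m_le|].
  move=> u /QltP[r rq /= ur]; apply: le_trans ur _.
  by apply: Hr; exact: ltW.
have KE q : ae_eq p setT (fun x => K x (ray q)) (H q \o phi).
  apply: ae_eq_of_le_integral => //.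
  - exact: mK.
  - by move=> x _; exact: H0.
  - by apply: filterS (KleH q) => x.
  - apply: le_lt_trans (p_lty _ (mFray q)); rewrite -HET.
    apply: ae_ge0_le_integral => //; [exact: mK|exact: mHphi|].
    by apply: filterS (KleH q) => x.
  (* Conversely [u <= H r] with [r < q] gives [Q < q]; letting [r] increase to [q] bounds the
     integral from below. *)
  - rewrite [leLHS]HET; apply: ray_lim => r rq; rewrite -HET.
    apply: ae_ge0_le_integral => //; [exact: mHphi|exact: mK|].
    apply: filterS (Hle1 r) => x Hr1 _.
    rewrite KxE -[leLHS]unit_interval_measure_le ?H0//.
    apply: le_measure; rewrite ?inE; [exact: m_le|exact: mKs|].
    by move=> u /= ur; apply/QltP; exists r.
move=> A B mA mB.
have mphiBT : measurable (phi @^-1` B `*` [set: R]).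
  by apply: measurableX => //; exact: mphiB.
(* For fixed [B] both sides of the goal are finite measures in [A], so rational rays suffice. *)
pose m1 := mpushforward (mrestr (p \x @unit_interval_measure R) mphiBT) mQphi.
pose m2 := mpushforward (mrestr p (mphiB mB)) mF.
have m1E C : m1 C = \int[p]_(x in phi @^-1` B) K x C.
  rewrite [RHS]integral_mkcond; apply: eq_integral => x _; rewrite patchE /=.
  case: ifPn => [|]; rewrite ?inE ?notin_setE => Bx.
    congr (unit_interval_measure _); rewrite xsectionE.
    by apply/seteqP; split => u //= -[].
  rewrite -[RHS](measure0 (@unit_interval_measure R)).
  congr (unit_interval_measure _); rewrite xsectionE.
  by apply/seteqP; split => u //= -[_ []].
rewrite -[RHS]/(m2 A) -[LHS]m1E.
have KT : m1 setT = p (phi @^-1` B).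
  rewrite m1E (eq_integral (cst 1)); last by move=> x _; exact: prob_kernel.
  by rewrite integral_cst ?mul1e//; exact: mphiB.
apply: measure_unique_rat_rays => //.
- by rewrite KT; apply: p_lty; exact: mphiB.
- by rewrite KT /m2 /= /mpushforward /= /pushforward /mrestr preimage_setT setTI.
- move=> q; rewrite m1E -[RHS]HE//; apply: ae_eq_integral => //.
  - exact: mphiB.
  - by apply: measurable_funTS; exact: (mK _ (mray q)).
  - by apply: measurable_funTS; exact: mHphi.
  - by apply: filterS (KE q) => x /(_ Logic.I).
Qed.

End conditional_distribution.

(** Take for [T] the set [X] with the sigma-algebra [G], for [phi] the identity, and carry the
    conditional quantile of the embedding [F] back to [X] by its left inverse [g]. *)
Lemma rcp_exists (d : measure_display) (X : measurableType d) (R : realType)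
    (p : probability X R) (G : set (set X)) : @standard_borel d X R ->
  sigma_algebra setT G -> G `<=` measurable ->
  exists e : R.-pker X ~> X, is_rcp p G e.
Proof.
move=> hX sG Gm.
have [[x0 _]|X0] := pselect (exists x : X, True); last first.
  have := @probability_setT _ _ _ p.
  rewrite (_ : [set: X] = set0) ?measure0; first by move=> /eqP; rewrite eq_sym onee_eq0.
  by apply/seteqP; split => x //; case: X0; exists x.
have [F [g [mF mg Fg]]] := standard_borel_retract x0 hX.
pose T := g_sigma_algebraType G.
have GE (A : set X) : G A <-> @measurable _ T A.
  by rewrite /measurable/= sigma_algebra_id.
pose phi : X -> T := id.
have mphi : measurable_fun setT phi.
  by move=> _ A /GE GA; rewrite setTI; exact: Gm.
have [Q [mQ QE]] := conditional_quantile_exists p mphi mF.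
have mZT : measurable_fun setT (g \o Q) by exact: measurableT_comp.
have mZ : measurable_fun setT (fun z : X * R => g (Q (phi z.1, z.2))).
  apply: measurableT_comp => //; apply: measurableT_comp => //.
  apply: measurable_fun_pair.
    by apply: measurableT_comp => //; exact: measurable_fst.
  exact: measurable_snd.
(* The same kernel with source [T]: its measurability is exactly the [G]-measurability required. *)
pose KT := @random_map_kernel _ _ _ _ _ _ R (@unit_interval_measure R) _ mZT.
exists (@random_map_kernel _ _ _ _ _ _ R (@unit_interval_measure R) _ mZ).
move=> A mA; split.
  move=> Y mY; apply/GE.
  have mKT : measurable_fun setT (KT ^~ A) by exact: (measurable_kernel KT).
  by have := mKT measurableT _ mY; rewrite setTI.
move=> B GB; have mB : @measurable _ T B by apply/GE.
have mgA : measurable (g @^-1` A) by rewrite -[X in measurable X]setTI; exact: mg.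
rewrite [RHS](_ : _ = p (F @^-1` (g @^-1` A) `&` phi @^-1` B)).
  by rewrite -QE.
by congr (p (_ `&` _)); apply/seteqP; split => x; rewrite /preimage /mkset Fg.
Qed.

Theorem theorem4p16 (d : measure_display) (X : measurableType d) (R : realType)
  (p : probability X R) (hX : @standard_borel d X R) :
  (* e |-> I_e is well defined on p-a.s. classes and lands in p-complete sub-sigma-algebras *)
  (forall e e' : R.-pker X ~> X, mp_idem p e -> mp_idem p e' ->
     kae p (fun x C => e x C) (fun x C => e' x C) -> inv_sets p e = inv_sets p e') /\
  (forall e : R.-pker X ~> X, mp_idem p e -> p_complete_subsigma p (inv_sets p e)) /\
  (* B |-> e_B is defined (regular conditional probabilities exist),
     lands in measure-preserving a.s. idempotent kernels, and I_{e_B} = B *)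
  (forall G, p_complete_subsigma p G ->
     (exists e : R.-pker X ~> X, is_rcp p G e) /\
     (forall e : R.-pker X ~> X, is_rcp p G e -> mp_idem p e /\ inv_sets p e = G)) /\
  (* e_{I_e} = e (p-a.s.) *)
  (forall e : R.-pker X ~> X, mp_idem p e ->
     forall e' : R.-pker X ~> X, is_rcp p (inv_sets p e) e' ->
       kae p (fun x C => e' x C) (fun x C => e x C)) /\
  (* order preservation, both directions *)
  (forall e1 e2 : R.-pker X ~> X, mp_idem p e1 -> mp_idem p e2 ->
     (kle p e1 e2 <-> inv_sets p e1 `<=` inv_sets p e2)) /\
  (forall (G1 G2 : set (set X)) (e1 e2 : R.-pker X ~> X),
     p_complete_subsigma p G1 -> p_complete_subsigma p G2 ->
     is_rcp p G1 e1 -> is_rcp p G2 e2 ->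
     (G1 `<=` G2 <-> kle p e1 e2)).
Proof.
split; first by move=> e e' _ _ ee'; apply/seteqP; split; apply: inv_sets_kae => //;
  apply: filterS ee' => x ee' C mC; rewrite ee'.
split; first by move=> e [mpe _]; exact: inv_sets_p_complete.
split.
  move=> G GG; split; first by case: GG => sG Gm _; exact: rcp_exists.
  by move=> e re; split; [exact: rcp_mp_idem re|exact: inv_sets_rcp].
split.
  move=> e mie e' re'; have [sI Im _] := inv_sets_p_complete mie.1.
  by apply: is_rcp_unique re' _ => //; exact: mp_idem_rcp.
have orderE e1 e2 : mp_idem p e1 -> mp_idem p e2 ->
    (kle p e1 e2 <-> inv_sets p e1 `<=` inv_sets p e2).
  move=> mi1 mi2; split; last exact: inv_sets_kle.
  by apply: kle_inv_sets; case: mi2.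
(* The order on sub-sigma-algebras reduces to that on kernels, as the invariant sets of [e1] and
   [e2] are [G1] and [G2]. *)
split=> // G1 G2 e1 e2 GG1 GG2 re1 re2.
have := orderE _ _ (rcp_mp_idem hX GG1 re1) (rcp_mp_idem hX GG2 re2).
by rewrite (inv_sets_rcp GG1 re1) (inv_sets_rcp GG2 re2) => -[? ?].
Qed.
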